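(* Let $\tau_M>0$, $h\ge\tau_M$, let $S$ be an admissible weighting function, and let $\tau:\mathbb{R}_{\ge 0}\to[0,\tau_M]$ be an unknown piecewise-continuous (fast-varying) delay, with no assumption on its derivative. Let $B=B_0+\Delta B\in\mathbb{R}$ with $B_0\in\mathbb{R}$, $B_0\neq0$ known and $|\Delta B|\le\varepsilon$, $\varepsilon\ge0$ known. Let $f(t,x)$ be unknown, continuous in $t$, locally Lipschitz in $x$, with $|f(t,x)|\le f_0|x|$, $f_0\ge0$ known, and let $w_1,w_2$ be piecewise continuous, locally bounded disturbances. Consider the scalar system $$\dot x(t)=Bu(t)+f(t,x(t))+w_1(t),\qquad y(t)=x(t-\tau(t))+w_2(t),\qquad x(t)\in\mathbb{R},$$ under the controller $$u(t)=-B_0W_{\mathrm c}^{-1}S(t)g(t)y(t-h),\qquad t\ge0,\qquad W_{\mathrm c}=B_0^2\int_{2h}^{3h}S(s)\,ds .$$ Let $\rho(l)$ and $\delta$ be the constants defined in the context, which contain a constant delay parameter $\tau_0\in[0,\tau_M]$, and assume that $\rho(l)<1$ for all $\tau_0\in[0,\tau_M]$ and all integers $l\ge1$. Then the solution of the closed-loop system satisfies, for all $t\ge6h$, $$|x(t)|\le|x|_{[0,6h]}\,e^{\frac{\ln(\rho(1))(t-6h)}{6h}}+\frac{\delta\,\bigl(|w_1|_{[0,t]}+|w_2|_{[0,t]}\bigr)}{(1-\rho(1))^2}.$$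
   Context: $|\phi|_J$ is the supremum of $|\phi|$ over the interval $J$. If $\rho(1)=0$ the exponential factor is read as $0$. Admissible weighting function: $S:\mathbb{R}_{\ge0}\to\mathbb{R}$ such that (1) $S$ is continuously differentiable and $3h$-periodic; (2) $S(t)\ge0$ on $[2h,3h]$ and $S(h_\ast)>0$ for some $h_\ast\in(2h,3h)$; (3) $S(2h)=S(3h)=0$, $S'(2h)=S'(3h)=0$. For $l\in\mathbb{Z}_{\ge0}$: $g(t)=0$ for $t\in[3lh,(3l+2)h]$, $g(t)=1$ for $t\in((3l+2)h,(3l+3)h)$. Constants. These are the constants of the corresponding estimate for the constant-delay measurement $y(t)=x(t-\tau_0)+w_2(t)$, where $\tau_0\in[0,\tau_M]$ is an unknown constant, taken in the case of system matrix $A=0$ (nilpotency index $q=1$, so that $3(q+1)h=6h$). For $s\in[2h,3h]$: $$\Delta(s)=1-\int_{2h}^{s}B_0^2S(r)\,dr\,W_{\mathrm c}^{-1},\qquad \Theta(s)=-\int_{2h}^{s}\Delta B\,S(r)B_0\,dr\,W_{\mathrm c}^{-1},$$ $$F=-\int_{2h}^{3h}\Delta B\,S(s)B_0\,ds\,W_{\mathrm c}^{-1},\qquad \eta=\sup_{s\in[2h,3h]}\{1+|\Delta(s)|+|\Theta(s)|\},$$ $$\alpha_1=\int_{2h}^{3h}|BS(s)B_0W_{\mathrm c}^{-1}|\,(s-h-\tau_0)\,ds+3h,\qquad \alpha_2=\int_{2h}^{3h}|BS(s)B_0W_{\mathrm c}^{-1}|\,ds,$$ $$\rho_1=\alpha_1\,\eta\sup_{l\in\mathbb{N}}\left\{\sum_{i=0}^{l-1}|F^i|\right\}+3h+\alpha_1,\qquad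 \rho(l)=\eta|F^l|+\rho_1f_0,$$ $$\delta=\eta\sup_{l\in\mathbb{Z}_{\ge0}}\left\{\sum_{i=0}^{l-1}|F^i|\right\}(\alpha_1+\alpha_2)+3h+\alpha_1+\alpha_2 .$$ *)

(* Defs.v *)
From Stdlib Require Import Reals List.
From Coquelicot Require Import Coquelicot.
Open Scope R_scope.

(* Functions on the half-line R_{>=0} are total functions R -> R
   constrained only at nonnegative arguments: continuity and derivatives there
   are relative to [half_line], hence one-sided at 0. *)
Definition half_line (t : R) : Prop := 0 <= t.

Definition sup_on (phi : R -> R) (a b : R) : R :=
  real (Lub_Rbar (fun r => exists t, a <= t <= b /\ r = phi t)).

Definition norm_on (phi : R -> R) (a b : R) : R :=
  sup_on (fun t => Rabs (phi t)) a b.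

Definition locally_finite (D : R -> Prop) : Prop :=
  forall T, exists pts : list R, forall t, 0 <= t <= T -> D t -> In t pts.

Definition piecewise_continuous (w : R -> R) : Prop :=
  (exists D, locally_finite D /\
     forall t, half_line t -> ~ D t -> continue_in w half_line t) /\
  (forall t, half_line t -> exists l, limit1_in w (fun s => t < s) l t) /\
  (forall t, 0 < t -> exists l, limit1_in w (fun s => 0 <= s < t) l t).

Definition locally_bounded (w : R -> R) : Prop :=
  forall T, exists M, forall t, 0 <= t <= T -> Rabs (w t) <= M.

(* The Lipschitz constant is uniform on a neighbourhood of (t0, x0) in
   R_{>=0} x R. *)
Definition locally_lipschitz_in_x (f : R -> R -> R) : Prop :=
  forall t0 x0, 0 <= t0 ->
    exists r L, 0 < r /\
      forall t x z, 0 <= t -> Rabs (t - t0) < r ->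
        Rabs (x - x0) < r -> Rabs (z - x0) < r ->
        Rabs (f t x - f t z) <= L * Rabs (x - z).

Definition admissible_weight (h : R) (S : R -> R) : Prop :=
  exists dS : R -> R,
    (forall t, half_line t -> D_in S dS half_line t /\ continue_in dS half_line t) /\
    (forall t, 0 <= t -> S (t + 3 * h) = S t) /\
    (forall t, 2 * h <= t <= 3 * h -> 0 <= S t) /\
    (exists hs, 2 * h < hs < 3 * h /\ 0 < S hs) /\
    S (2 * h) = 0 /\ S (3 * h) = 0 /\ dS (2 * h) = 0 /\ dS (3 * h) = 0.

Definition is_gate (h : R) (g : R -> R) : Prop :=
  forall (l : nat) (t : R),
    (3 * INR l * h <= t <= (3 * INR l + 2) * h -> g t = 0) /\
    ((3 * INR l + 2) * h < t < (3 * INR l + 3) * h -> g t = 1).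

Definition Wc (h B0 : R) (S : R -> R) : R :=
  B0 ^ 2 * RInt S (2 * h) (3 * h).

Definition output (x tau w2 : R -> R) (t : R) : R := x (t - tau t) + w2 t.

(* For t < h the value y (t - h) is multiplied by g t = 0, so no initial
   history is needed. *)
Definition control (h B0 : R) (S g y : R -> R) (t : R) : R :=
  - B0 * / Wc h B0 S * S t * g t * y (t - h).

(* Continuous on R_{>=0}, and satisfying the differential equation off a locally
   finite set, since the right-hand side is only piecewise continuous in t. *)
Definition closed_loop_solution (h B0 dB : R) (S g tau : R -> R)
    (f : R -> R -> R) (w1 w2 x : R -> R) : Prop :=
  (forall t, half_line t -> continue_in x half_line t) /\
  exists D, locally_finite D /\
    forall t, 0 < t -> ~ D t ->
      is_derive x t
        ((B0 + dB) * control h B0 S g (output x tau w2) t + f t (x t) + w1 t).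

Definition Delta (h B0 : R) (S : R -> R) (s : R) : R :=
  1 - RInt (fun r => B0 ^ 2 * S r) (2 * h) s * / Wc h B0 S.

Definition Theta (h B0 dB : R) (S : R -> R) (s : R) : R :=
  - RInt (fun r => dB * S r * B0) (2 * h) s * / Wc h B0 S.

Definition Fmat (h B0 dB : R) (S : R -> R) : R :=
  - RInt (fun s => dB * S s * B0) (2 * h) (3 * h) * / Wc h B0 S.

Definition eta (h B0 dB : R) (S : R -> R) : R :=
  sup_on (fun s => 1 + Rabs (Delta h B0 S s) + Rabs (Theta h B0 dB S s))
    (2 * h) (3 * h).

Definition alpha1 (h B0 dB tau0 : R) (S : R -> R) : R :=
  RInt (fun s => Rabs ((B0 + dB) * S s * B0 * / Wc h B0 S) * (s - h - tau0))
    (2 * h) (3 * h) + 3 * h.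

Definition alpha2 (h B0 dB : R) (S : R -> R) : R :=
  RInt (fun s => Rabs ((B0 + dB) * S s * B0 * / Wc h B0 S)) (2 * h) (3 * h).

Definition abs_power_sum (F : R) (l : nat) : R :=
  fold_right Rplus 0 (map (fun i => Rabs (F ^ i)) (seq 0 l)).

(* The supremum over l of sum_{i < l} |F^i|.  It is infinite, and this real
   projection is then meaningless, exactly when |F| >= 1; but eta >= 2, so the
   condition rho(1) < 1 already fails in that case through its term eta |F|. *)
Definition sup_power_sum (F : R) : R :=
  real (Sup_seq (fun l => Finite (abs_power_sum F l))).

Definition rho1 (h B0 dB tau0 : R) (S : R -> R) : R :=
  alpha1 h B0 dB tau0 S * eta h B0 dB S * sup_power_sum (Fmat h B0 dB S)
  + 3 * h + alpha1 h B0 dB tau0 S.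

Definition rho (h B0 dB f0 tau0 : R) (S : R -> R) (l : nat) : R :=
  eta h B0 dB S * Rabs (Fmat h B0 dB S ^ l) + rho1 h B0 dB tau0 S * f0.

Definition delta (h B0 dB tau0 : R) (S : R -> R) : R :=
  eta h B0 dB S * sup_power_sum (Fmat h B0 dB S)
    * (alpha1 h B0 dB tau0 S + alpha2 h B0 dB S)
  + 3 * h + alpha1 h B0 dB tau0 S + alpha2 h B0 dB S.

(* exp (ln r * (t - 6h) / (6h)), read as 0 when r = 0. *)
Definition decay (h r t : R) : R :=
  if Req_EM_T r 0 then 0 else exp (ln r * (t - 6 * h) / (6 * h)).

(* Main.v *)
Require Import Defs.
From Stdlib Require Import Reals List Lra.
From Coquelicot Require Import Coquelicot.
Open Scope R_scope.

(* On [3lh, (3l+2)h] the input vanishes and on the last third of the period it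
   only uses values of x from that free phase, whatever the delay.  Hence, with
   m(s) = (B / B0) * int_2h^s S / int_2h^3h S, the state at 3lh + s is
   (1 - m(s)) x(3lh) up to an error driven by f, w1 and w2; here
   1 - m = Delta + Theta, which equals F at s = 3h.  Composing two windows gives
   |x(t)| <= rho(1) |x|_[t-6h,t] + delta (|w1| + |w2|) for t >= 6h, and a
   Halanay-type argument turns this into exponential decay.

   Since the claim is made for every tau0, in particular for tau0 = tauM, the
   error must not be bounded through int k(s) (s - h - tau) ds with the actual
   delay, which may exceed alpha1.  The contribution of f and w1 to the error is
   in fact at most 3h (f0 |x| + |w1|) <= alpha1 (f0 |x| + |w1|), because
   0 <= m <= 2: this is a consequence of rho(1) < 1, which forces |F| < 1/2. *)

(** * Mean value inequalities and suprema *)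

Lemma continuity_pt_half_line (phi : R -> R) (t : R) :
  continue_in phi half_line t -> 0 < t -> continuity_pt phi t.
Proof.
  intros Hc Ht e He.
  destruct (Hc e He) as [d [Hd Hlim]].
  exists (Rmin d t); split; [now apply Rmin_pos|].
  intros s [[_ Hne] Hs]; apply Hlim.
  simpl in Hs |- *; unfold Rdist in *.
  assert (Rmin d t <= d) by apply Rmin_l.
  assert (Rmin d t <= t) by apply Rmin_r.
  repeat split; try assumption; try lra.
  unfold half_line; apply Rabs_def2 in Hs; lra.
Qed.

(** Freezing [phi] at [phi 0] on the negative axis turns one-sided continuity at 0 into the
    two-sided continuity that theorems on segments require. As [Rmax 0] is 1-Lipschitz, the same
    radius works. *)
Lemma continuity_pt_extend (phi : R -> R) :
  (forall t, half_line t -> continue_in phi half_line t) ->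
  forall t, continuity_pt (fun s => phi (Rmax 0 s)) t.
Proof.
  intros Hc t e He.
  destruct (Hc (Rmax 0 t) (Rmax_l 0 t) e He) as [d [Hd Hlim]].
  exists d; split; [assumption|].
  intros s [_ Hs]; simpl in *; unfold Rdist in *.
  destruct (Req_dec (Rmax 0 t) (Rmax 0 s)) as [Heq|Hneq].
  - rewrite Heq, Rminus_diag, Rabs_R0; assumption.
  - apply Hlim; repeat split; try apply Rmax_l; try assumption.
    apply Rle_lt_trans with (2 := Hs).
    unfold Rmax; destruct (Rle_dec 0 s), (Rle_dec 0 t);
      unfold Rabs; repeat destruct Rcase_abs; lra.
Qed.

(** Without exceptional points, [psi - sg * phi] is nondecreasing for [sg = 1] and [sg = -1]. An
    exceptional point inside the interval splits it, and the two estimates add up. The bound is a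
    function [psi] because the input gain varies with time on the last third of a period. *)
Lemma mean_value_inequality (pts : list R) (phi psi : R -> R) (a b : R) :
  a <= b ->
  (forall t, a <= t <= b -> continuity_pt phi t /\ continuity_pt psi t) ->
  (forall t, a < t < b -> ~ In t pts ->
     exists dphi dpsi, is_derive phi t dphi /\ is_derive psi t dpsi /\
       Rabs dphi <= dpsi) ->
  Rabs (phi b - phi a) <= psi b - psi a.
Proof.
  revert a b; induction pts as [|p pts IH]; intros a b Hab Hcont Hder.
  - assert (Hmono : forall sg, Rabs sg <= 1 ->
      0 <= psi b - psi a - sg * (phi b - phi a)).
    { intros sg Hsg.
      (* [MVT_gen] may return an endpoint, where the sign of the derivative is
         unknown, hence the truncation at 0, which changes nothing inside. *)
      pose (d t := Rmax 0 (Derive psi t - sg * Derive phi t)).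
      destruct (MVT_gen (fun t => psi t - sg * phi t) a b d)
        as [c [Hc Heq]].
      - rewrite Rmin_left, Rmax_right by assumption; intros t Ht.
        destruct (Hder t Ht (fun H => H)) as (d1 & d2 & H1 & H2 & Hle).
        unfold d; rewrite (is_derive_unique _ _ _ H1), (is_derive_unique _ _ _ H2).
        assert (Rabs (sg * d1) <= d2).
        { rewrite Rabs_mult; pose proof (Rabs_pos d1); pose proof (Rabs_pos sg); nra. }
        rewrite Rmax_right by (pose proof (Rle_abs (sg * d1)); lra).
        apply (is_derive_minus psi (fun t => sg * phi t)); [assumption|].
        now apply is_derive_scal.
      - rewrite Rmin_left, Rmax_right by assumption; intros t Ht.
        destruct (Hcont t Ht); apply continuity_pt_minus; [assumption|].
        now apply continuity_pt_scal.
      - assert (0 <= d c * (b - a)).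
        { apply Rmult_le_pos; [apply Rmax_l | lra]. }
        lra. }
    assert (H1 : Rabs 1 <= 1) by (apply Rabs_le; lra).
    assert (H2 : Rabs (-1) <= 1) by (apply Rabs_le; lra).
    apply Hmono in H1; apply Hmono in H2; apply Rabs_le; lra.
  - destruct (Rlt_dec a p) as [Hap|Hap]; [destruct (Rlt_dec p b) as [Hpb|Hpb]|].
    + assert (H1 : Rabs (phi p - phi a) <= psi p - psi a).
      { apply IH; [lra | intros; apply Hcont; lra |].
        intros t Ht Hn; apply Hder; [lra|].
        intros [->|H]; [lra | contradiction]. }
      assert (H2 : Rabs (phi b - phi p) <= psi b - psi p).
      { apply IH; [lra | intros; apply Hcont; lra |].
        intros t Ht Hn; apply Hder; [lra|].
        intros [->|H]; [lra | contradiction]. }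
      replace (phi b - phi a) with ((phi b - phi p) + (phi p - phi a)) by ring.
      eapply Rle_trans; [apply Rabs_triang | lra].
    + apply IH; try assumption.
      intros t Ht Hn; apply Hder; [lra|].
      intros [->|H]; [lra | contradiction].
    + apply IH; try assumption.
      intros t Ht Hn; apply Hder; [lra|].
      intros [->|H]; [lra | contradiction].
Qed.

Lemma mean_value_half_line (pts : list R) (phi : R -> R) (M a b : R) :
  0 <= a <= b ->
  (forall t, half_line t -> continue_in phi half_line t) ->
  (forall t, a < t < b -> ~ In t pts ->
     exists d, is_derive phi t d /\ Rabs d <= M) ->
  Rabs (phi b - phi a) <= M * (b - a).
Proof.
  intros Hab Hcont Hder.
  pose proof (mean_value_inequality pts (fun t => phi (Rmax 0 t))
    (fun t => M * t) a b) as H.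
  simpl in H; rewrite !Rmax_right in H by lra.
  rewrite Rmult_minus_distr_l; apply H; [lra | |].
  - intros t _; split; [now apply continuity_pt_extend | reg].
  - intros t Ht Hn; destruct (Hder t Ht Hn) as (d & Hd & Hle).
    exists d, M; split; [ | split; [auto_derive; [exact I | ring] | assumption]].
    apply is_derive_ext_loc with (2 := Hd).
    assert (Ht0 : 0 < t) by lra.
    exists (mkposreal t Ht0); intros s Hs; rewrite Rmax_right; [reflexivity|].
    apply Rabs_def2 in Hs; unfold minus, plus, opp in Hs; simpl in Hs; lra.
Qed.

Lemma bounded_on_segment (phi : R -> R) (T : R) :
  (forall t, half_line t -> continue_in phi half_line t) ->
  exists M, forall t, 0 <= t <= T -> Rabs (phi t) <= M.
Proof.
  intros Hcont.
  destruct (Rle_dec 0 T) as [HT|HT]; [|exists 0; intros; lra].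
  destruct (continuity_ab_maj (fun t => Rabs (phi (Rmax 0 t))) 0 T HT)
    as (m & Hm & _).
  - intros c _; apply (continuity_pt_comp (fun t => phi (Rmax 0 t)) Rabs);
      [now apply continuity_pt_extend | apply Rcontinuity_abs].
  - exists (Rabs (phi (Rmax 0 m))); intros t Ht.
    specialize (Hm t Ht); simpl in Hm; now rewrite Rmax_right in Hm by lra.
Qed.

(** The projection from [Rbar] is faithful only for a finite supremum: [M] excludes [p_infty], and
    the value at [t] excludes [m_infty]. *)
Lemma sup_on_ub (phi : R -> R) (a b M t : R) :
  (forall s, a <= s <= b -> phi s <= M) -> a <= t <= b -> phi t <= sup_on phi a b.
Proof.
  intros HM Ht; unfold sup_on.
  set (E := fun r => exists s, a <= s <= b /\ r = phi s).
  destruct (Lub_Rbar_correct E) as [Hub Hleast].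
  assert (H1 : Rbar_le (phi t) (Lub_Rbar E)) by (apply Hub; now exists t).
  assert (H2 : Rbar_le (Lub_Rbar E) M).
  { apply Hleast; intros r (s & Hs & ->); now apply HM. }
  now destruct (Lub_Rbar E).
Qed.

Lemma norm_on_ub (phi : R -> R) (a b M t : R) :
  (forall s, a <= s <= b -> Rabs (phi s) <= M) -> a <= t <= b ->
  Rabs (phi t) <= norm_on phi a b.
Proof. exact (sup_on_ub (fun s => Rabs (phi s)) a b M t). Qed.

Lemma abs_power_sum_geometric (F : R) (l : nat) :
  abs_power_sum F l * (1 - Rabs F) = 1 - Rabs F ^ l.
Proof.
  unfold abs_power_sum.
  (* The induction shifts the start of [seq], hence the arbitrary start [i]. *)
  enough (H : forall i, fold_right Rplus 0 (map (fun j => Rabs (F ^ j)) (seq i l))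
      * (1 - Rabs F) = Rabs F ^ i * (1 - Rabs F ^ l)).
  { rewrite H; simpl; ring. }
  induction l as [|l IH]; intros i; simpl; [ring|].
  rewrite Rmult_plus_distr_r, IH, <- RPow_abs; simpl; ring.
Qed.

(** The empty sum makes a finite supremum nonnegative, and an infinite one projects to 0. No bound
    on [F] is assumed, so that this can serve to derive one. *)
Lemma sup_power_sum_nonneg (F : R) : 0 <= sup_power_sum F.
Proof.
  unfold sup_power_sum.
  pose proof (Sup_seq_correct (fun l => Finite (abs_power_sum F l))) as H.
  destruct (Sup_seq _) as [r| |]; simpl; try lra.
  destruct (Rle_dec 0 r) as [|Hr]; [assumption|].
  assert (Hp : 0 < - r) by lra.
  destruct (H (mkposreal _ Hp)) as [H0 _]; specialize (H0 0%nat).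
  unfold abs_power_sum in H0; simpl in H0; lra.
Qed.

(** The sum with [l = 1] is already 1; the geometric identity bounds all sums by [/ (1 - Rabs F)]
    and so rules out an infinite supremum. *)
Lemma sup_power_sum_ge_1 (F : R) : Rabs F < 1 -> 1 <= sup_power_sum F.
Proof.
  intros HF; unfold sup_power_sum.
  pose proof (Sup_seq_correct (fun l => Finite (abs_power_sum F l))) as H.
  assert (H1 : abs_power_sum F 1 = 1).
  { unfold abs_power_sum; simpl; rewrite Rabs_R1; ring. }
  destruct (Sup_seq _) as [r| |]; simpl in H |- *.
  - destruct (Rle_dec 1 r) as [|Hr]; [assumption|].
    assert (Hp : 0 < 1 - r) by lra.
    destruct (H (mkposreal _ Hp)) as [H0 _]; specialize (H0 1%nat).
    simpl in H0; lra.
  - destruct (H (/ (1 - Rabs F))) as [l Hl].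
    pose proof (abs_power_sum_geometric F l) as Hg.
    assert (0 <= Rabs F ^ l) by (apply pow_le, Rabs_pos).
    apply (Rmult_lt_compat_r (1 - Rabs F)) in Hl; [|lra].
    rewrite Hg, Rinv_l in Hl; lra.
  - specialize (H 0 1%nat); lra.
Qed.

(** * Exponential decay from a delayed inequality *)

Lemma decay_pos (h r t : R) : r <> 0 -> 0 < decay h r t.
Proof. intros Hr; unfold decay; destruct Req_EM_T; [easy | apply exp_pos]. Qed.

Lemma decay_nonincreasing (h r s t : R) :
  0 < h -> 0 <= r < 1 -> s <= t -> decay h r t <= decay h r s.
Proof.
  intros Hh Hr Hst; unfold decay; destruct Req_EM_T; [lra|].
  assert (Hln : ln r < 0) by (rewrite <- ln_1; apply ln_increasing; lra).
  assert (Hle : ln r * (t - 6 * h) / (6 * h) <= ln r * (s - 6 * h) / (6 * h)).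
  { apply Rmult_le_compat_r; [left; apply Rinv_0_lt_compat; lra | nra]. }
  destruct Hle as [Hlt | ->]; [left; now apply exp_increasing | apply Rle_refl].
Qed.

Lemma decay_ge_1 (h r t : R) :
  0 < h -> 0 < r < 1 -> t <= 6 * h -> 1 <= decay h r t.
Proof.
  intros Hh Hr Ht.
  apply Rle_trans with (decay h r (6 * h)); [|apply decay_nonincreasing; lra].
  unfold decay; destruct Req_EM_T; [lra|].
  replace (ln r * (6 * h - 6 * h) / (6 * h)) with 0 by (field; lra).
  rewrite exp_0; apply Rle_refl.
Qed.

(** The rate [ln r / (6 * h)] is the one for which a window of length [6 * h] costs exactly the
    factor [r] of the recursion. *)
Lemma decay_shift (h r t : R) :
  0 < h -> 0 < r -> r * decay h r (t - 6 * h) = decay h r t.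
Proof.
  intros Hh Hr; unfold decay; destruct Req_EM_T; [lra|].
  rewrite <- (exp_ln r) at 1 by assumption.
  rewrite <- exp_plus; f_equal; field; lra.
Qed.

(* If [m > 0] is the supremum of the excess of [v] over the claimed bound, the
   recursion improves it to [r * m]. *)
Lemma halanay_bound (v : R -> R) (h r C V T : R) :
  0 < h -> 0 <= r < 1 -> 0 <= C -> 0 <= V ->
  (exists M, forall t, 0 <= t <= T -> v t <= M) ->
  (forall t, 0 <= t <= 6 * h -> v t <= V) ->
  (forall t X, 6 * h <= t <= T -> (forall s, t - 6 * h <= s <= t -> v s <= X) ->
     v t <= r * X + C) ->
  forall t, 6 * h <= t <= T -> v t <= V * decay h r t + C / (1 - r).
Proof.
  intros Hh Hr HC HV [M HM] Hinit Hrec.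
  (* [D] is the fixed point of the map sending [X] to [r * X + C]. *)
  set (D := C / (1 - r)).
  assert (HD : r * D + C = D) by (unfold D; field; lra).
  assert (HD0 : 0 <= D).
  { apply Rmult_le_pos; [assumption | left; apply Rinv_0_lt_compat; lra]. }
  (* At [r = 0] the decay term is 0, and one use of the recursion with the crude bound [M]
     suffices. *)
  destruct (Req_dec r 0) as [-> | Hr0].
  { intros t Ht; unfold decay; destruct Req_EM_T as [_|]; [|easy].
    assert (H := Hrec t M Ht ltac:(intros; apply HM; lra)); lra. }
  assert (Hstep : forall m, 0 <= m ->
    (forall t, 0 <= t <= T -> v t <= V * decay h r t + D + m) ->
    forall t, 0 <= t <= T -> v t <= V * decay h r t + D + r * m).
  { intros m Hm HX t Ht.
    (* On the initial window the decay factor is at least 1, so [V] suffices. Later it is largest at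
       the left end of the window, where [decay_shift] applies. *)
    destruct (Rle_dec t (6 * h)) as [Hth|Hth].
    - assert (H1 := Hinit t ltac:(lra)).
      assert (H2 := decay_ge_1 h r t Hh ltac:(lra) Hth); nra.
    - assert (H := Hrec t (V * decay h r (t - 6 * h) + D + m) ltac:(lra)).
      rewrite <- (decay_shift h r t) by lra.
      enough (v t <= r * (V * decay h r (t - 6 * h) + D + m) + C) by nra.
      apply H; intros s Hs.
      assert (H1 := HX s ltac:(lra)).
      assert (H2 := decay_nonincreasing h r (t - 6 * h) s Hh ltac:(lra) ltac:(lra)).
      nra. }
  intros t Ht.
  set (E := fun m => exists s, 0 <= s <= T /\ m = v s - V * decay h r s - D).
  destruct (completeness E) as [m [Hub Hleast]].
  { exists M; intros m (s & Hs & ->).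
    assert (H1 := HM s Hs); assert (H2 := decay_pos h r s Hr0); nra. }
  { exists (v t - V * decay h r t - D), t; split; [lra | reflexivity]. }
  assert (Hm : forall s, 0 <= s <= T -> v s <= V * decay h r s + D + m).
  { intros s Hs; enough (v s - V * decay h r s - D <= m) by lra.
    apply Hub; now exists s. }
  destruct (Rle_dec m 0) as [Hneg|Hpos]; [assert (H := Hm t ltac:(lra)); lra|].
  assert (m <= r * m); [|nra].
  apply Hleast; intros z (s & Hs & ->).
  assert (H := Hstep m ltac:(lra) Hm s Hs); lra.
Qed.

(** * The weight and the constants *)

Lemma RInt_proportional (phi psi : R -> R) (c a b : R) :
  ex_RInt psi a b ->
  (forall r, Rmin a b < r < Rmax a b -> phi r = c * psi r) ->
  RInt phi a b = c * RInt psi a b.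
Proof.
  intros Hex Heq.
  rewrite (RInt_ext phi (fun r => scal c (psi r))) by exact Heq.
  now rewrite (RInt_scal psi).
Qed.

Section Weight.

Context (h : R) (S : R -> R) (Hh : 0 < h) (HS : admissible_weight h S).

Lemma weight_continuous (t : R) : 0 < t -> continuous S t.
Proof.
  intros Ht; destruct HS as (dS & Hd & _).
  apply continuity_pt_filterlim, continuity_pt_half_line; [|assumption].
  apply cont_deriv with dS, Hd; unfold half_line; lra.
Qed.

Lemma weight_ex_RInt (a b : R) : 0 < a -> 0 < b -> ex_RInt S a b.
Proof.
  intros Ha Hb; apply (ex_RInt_continuous S); intros t Ht.
  apply weight_continuous; apply Rlt_le_trans with (2 := proj1 Ht).
  now apply Rmin_glb_lt.
Qed.

Lemma weight_nonneg (t : R) : 2 * h <= t <= 3 * h -> 0 <= S t.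
Proof. destruct HS as (dS & _ & _ & H & _); apply H. Qed.

Lemma weight_shift (l : nat) (t : R) : 0 <= t -> S (3 * INR l * h + t) = S t.
Proof.
  intros Ht; destruct HS as (dS & _ & Hper & _).
  induction l as [|l IH]; [simpl; f_equal; ring|].
  rewrite <- IH, <- (Hper (3 * INR l * h + t)).
  - f_equal; rewrite S_INR; ring.
  - pose proof (pos_INR l); nra.
Qed.

Lemma weight_mass_nonneg (a b : R) :
  2 * h <= a <= b -> b <= 3 * h -> 0 <= RInt S a b.
Proof.
  intros Ha Hb; apply RInt_ge_0; [lra | apply weight_ex_RInt; lra |].
  intros; apply weight_nonneg; lra.
Qed.

Lemma weight_mass_split (a b c : R) :
  0 < a -> 0 < b -> 0 < c -> RInt S a b + RInt S b c = RInt S a c.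
Proof. intros; apply (RInt_Chasles S); now apply weight_ex_RInt. Qed.

Lemma weight_mass_pos : 0 < RInt S (2 * h) (3 * h).
Proof.
  destruct HS as (dS & _ & _ & _ & (hs & Hhs & Hpos) & _).
  destruct (proj2 (continuity_pt_filterlim S hs) (weight_continuous hs ltac:(lra))
              (S hs) Hpos) as [d [Hd Hlim]].
  (* Halving makes the inclusions strict: the closed interval of radius [e] around [hs] stays where
     [S] is positive and inside the last third. *)
  set (e := Rmin d (Rmin (hs - 2 * h) (3 * h - hs)) / 2).
  assert (He : 0 < e).
  { unfold e; assert (0 < Rmin d (Rmin (hs - 2 * h) (3 * h - hs)));
      [repeat apply Rmin_pos; lra | lra]. }
  assert (Hed : e < d /\ e < hs - 2 * h /\ e < 3 * h - hs).
  { pose proof (Rmin_l d (Rmin (hs - 2 * h) (3 * h - hs))).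
    pose proof (Rmin_r d (Rmin (hs - 2 * h) (3 * h - hs))).
    pose proof (Rmin_l (hs - 2 * h) (3 * h - hs)).
    pose proof (Rmin_r (hs - 2 * h) (3 * h - hs)).
    unfold e in *; lra. }
  rewrite <- (weight_mass_split (2 * h) (hs - e)),
    <- (weight_mass_split (hs - e) (hs + e)) by lra.
  assert (H1 := weight_mass_nonneg (2 * h) (hs - e) ltac:(lra) ltac:(lra)).
  assert (H3 := weight_mass_nonneg (hs + e) (3 * h) ltac:(lra) ltac:(lra)).
  enough (0 < RInt S (hs - e) (hs + e)) by lra.
  apply RInt_gt_0; [lra | | intros; apply weight_continuous; lra].
  intros t Ht; destruct (Req_dec hs t) as [<-|Hne]; [assumption|].
  assert (H : Rabs (S t - S hs) < S hs).
  { apply (Hlim t); split; [now split|].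
    simpl; unfold Rdist; apply Rabs_def1; lra. }
  apply Rabs_def2 in H; lra.
Qed.

(** This is the distribution function of the weight normalised to mass 1. Both [Delta] and [Theta]
    are affine in it, as the powers of [B0] cancel up to the ratio [dB / B0]. *)
Definition weight_fraction (s : R) : R :=
  RInt S (2 * h) s / RInt S (2 * h) (3 * h).

Lemma weight_fraction_bounds (s : R) :
  2 * h <= s <= 3 * h -> 0 <= weight_fraction s <= 1.
Proof.
  intros Hs; pose proof weight_mass_pos as HI.
  assert (H1 := weight_mass_nonneg (2 * h) s ltac:(lra) ltac:(lra)).
  assert (H2 := weight_mass_nonneg s (3 * h) ltac:(lra) ltac:(lra)).
  assert (H3 := weight_mass_split (2 * h) s (3 * h) ltac:(lra) ltac:(lra) ltac:(lra)).
  unfold weight_fraction; split.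
  - apply Rmult_le_pos; [lra | left; now apply Rinv_0_lt_compat].
  - apply Rmult_le_reg_r with (1 := HI).
    unfold Rdiv; rewrite Rmult_assoc, Rinv_l; lra.
Qed.

Lemma weight_fraction_start : weight_fraction (2 * h) = 0.
Proof.
  unfold weight_fraction; rewrite RInt_point; unfold zero; simpl.
  unfold Rdiv; ring.
Qed.

Lemma weight_fraction_end : weight_fraction (3 * h) = 1.
Proof. pose proof weight_mass_pos; unfold weight_fraction; field; lra. Qed.

Lemma weight_fraction_derive (s : R) :
  0 < s -> is_derive weight_fraction s (S s / RInt S (2 * h) (3 * h)).
Proof.
  intros Hs.
  apply is_derive_ext with
    (fun r => / RInt S (2 * h) (3 * h) * RInt S (2 * h) r).
  { intros r; unfold weight_fraction, Rdiv; apply Rmult_comm. }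
  unfold Rdiv; rewrite (Rmult_comm (S s)); apply is_derive_scal.
  apply is_derive_RInt with (2 * h); [|now apply weight_continuous].
  exists (mkposreal s Hs); intros b Hb; apply (RInt_correct S).
  apply weight_ex_RInt; [lra|].
  apply Rabs_def2 in Hb; unfold minus, plus, opp in Hb; simpl in Hb; lra.
Qed.

(** * Closed forms and bounds for the constants of the estimate *)

Context (B0 dB : R) (HB0 : B0 <> 0).

Lemma Wc_neq_0 : Wc h B0 S <> 0.
Proof.
  pose proof weight_mass_pos; unfold Wc.
  apply Rmult_integral_contrapositive_currified; [now apply pow_nonzero | lra].
Qed.

Lemma Delta_fraction (s : R) :
  2 * h <= s <= 3 * h -> Defs.Delta h B0 S s = 1 - weight_fraction s.
Proof.
  intros Hs; pose proof weight_mass_pos; unfold Defs.Delta, Wc, weight_fraction.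
  rewrite (RInt_proportional _ S (B0 ^ 2)) by
    (reflexivity || apply weight_ex_RInt; lra).
  field; split; [lra | assumption].
Qed.

Lemma Theta_fraction (s : R) :
  2 * h <= s <= 3 * h -> Theta h B0 dB S s = - (dB / B0) * weight_fraction s.
Proof.
  intros Hs; pose proof weight_mass_pos; unfold Theta, Wc, weight_fraction.
  rewrite (RInt_proportional _ S (dB * B0)) by
    (intros; ring || apply weight_ex_RInt; lra).
  field; split; [lra | assumption].
Qed.

Lemma Fmat_eq : Fmat h B0 dB S = - (dB / B0).
Proof.
  pose proof weight_fraction_end as H.
  pose proof (Theta_fraction (3 * h) ltac:(lra)) as HT.
  unfold Theta in HT; unfold Fmat; rewrite HT, H; ring.
Qed.

(** Since [S] is nonnegative on the last third, the absolute value only affects the ratio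
    [(B0 + dB) / B0]; the normalised weight integrates to 1. *)
Lemma alpha2_eq : alpha2 h B0 dB S = Rabs (1 + dB / B0).
Proof.
  pose proof weight_mass_pos as HI; unfold alpha2.
  rewrite (RInt_proportional _ S (Rabs (1 + dB / B0) / RInt S (2 * h) (3 * h))).
  - field; lra.
  - apply weight_ex_RInt; lra.
  - rewrite Rmin_left, Rmax_right by lra; intros r Hr.
    assert (H := weight_nonneg r ltac:(lra)).
    replace ((B0 + dB) * S r * B0 * / Wc h B0 S)
      with ((1 + dB / B0) * (S r / RInt S (2 * h) (3 * h))).
    + rewrite Rabs_mult, (Rabs_pos_eq (S r / _)); [field; lra|].
      apply Rmult_le_pos; [assumption | left; now apply Rinv_0_lt_compat].
    + unfold Wc; field; split; [lra | assumption].
Qed.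

(** The factor [s - h - tau0] is nonnegative for [s >= 2 * h], so the integral only adds to
    [3 * h]. *)
Lemma alpha1_ge (tau0 : R) : tau0 <= h -> 3 * h <= alpha1 h B0 dB tau0 S.
Proof.
  intros Ht; unfold alpha1.
  enough (0 <= RInt (fun s => Rabs ((B0 + dB) * S s * B0 * / Wc h B0 S)
                              * (s - h - tau0)) (2 * h) (3 * h)) by lra.
  apply RInt_ge_0; [lra | |].
  - apply (ex_RInt_continuous (V := R_CompleteNormedModule)).
    rewrite Rmin_left, Rmax_right by lra; intros s Hs.
    assert (Hc := weight_continuous s ltac:(lra)).
    apply (continuous_mult (K := R_AbsRing)).
    + apply (continuous_comp _ Rabs); [|apply continuous_Rabs].
      apply (continuous_mult (K := R_AbsRing)); [|apply continuous_const].
      apply (continuous_mult (K := R_AbsRing)); [|apply continuous_const].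
      apply (continuous_mult (K := R_AbsRing)); [apply continuous_const|assumption].
    + apply (ex_derive_continuous (K := R_AbsRing) (V := R_NormedModule)
        (fun r => r - h - tau0)).
      now auto_derive.
  - intros s Hs; apply Rmult_le_pos; [apply Rabs_pos | lra].
Qed.

Lemma eta_ge (s : R) :
  2 * h <= s <= 3 * h ->
  1 + Rabs (Defs.Delta h B0 S s) + Rabs (Theta h B0 dB S s) <= eta h B0 dB S.
Proof.
  intros Hs.
  (* The bound [2 + Rabs (dB / B0)] is crude; it only certifies that the supremum is finite. *)
  apply (sup_on_ub (fun s => 1 + Rabs (Defs.Delta h B0 S s) + Rabs (Theta h B0 dB S s))
    _ _ (2 + Rabs (dB / B0)) s); [|assumption].
  intros r Hr; rewrite Delta_fraction, Theta_fraction by assumption.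
  rewrite Rabs_mult, Rabs_Ropp.
  assert (H := weight_fraction_bounds r Hr).
  rewrite !Rabs_pos_eq with (x := weight_fraction r),
    Rabs_pos_eq with (x := 1 - weight_fraction r) by lra.
  pose proof (Rabs_pos (dB / B0)); nra.
Qed.

Lemma eta_ge_2 : 2 <= eta h B0 dB S.
Proof.
  pose proof (eta_ge (2 * h) ltac:(lra)) as H.
  rewrite Delta_fraction, weight_fraction_start, Rminus_0_r, Rabs_R1 in H by lra.
  pose proof (Rabs_pos (Theta h B0 dB S (2 * h))); lra.
Qed.

(** The transition factor is [Delta + Theta]. The summand 1 of [eta] is left over, and it later pays
    for the error of the second window. *)
Lemma eta_ge_transition (s : R) :
  2 * h <= s <= 3 * h ->
  Rabs (1 - (1 + dB / B0) * weight_fraction s) <= eta h B0 dB S - 1.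
Proof.
  intros Hs; pose proof (eta_ge s Hs) as H.
  rewrite Delta_fraction, Theta_fraction in H by assumption.
  replace (1 - (1 + dB / B0) * weight_fraction s)
    with ((1 - weight_fraction s) + - (dB / B0) * weight_fraction s) by ring.
  eapply Rle_trans; [apply Rabs_triang | lra].
Qed.

End Weight.

(** * The closed loop *)

Section ClosedLoop.

Context (tauM h B0 dB f0 : R) (S g tau : R -> R) (f : R -> R -> R)
  (w1 w2 x : R -> R).
Hypotheses (Hh : 0 < h) (HtauM : tauM <= h) (HS : admissible_weight h S)
  (Hg : is_gate h g) (Htau : forall t, 0 <= t -> 0 <= tau t <= tauM)
  (HB0 : B0 <> 0) (Hf0 : 0 <= f0)
  (Hf : forall t x, 0 <= t -> Rabs (f t x) <= f0 * Rabs x)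
  (Hx : closed_loop_solution h B0 dB S g tau f w1 w2 x).

Lemma drift_bound (t X W1 : R) :
  0 <= t -> Rabs (x t) <= X -> Rabs (w1 t) <= W1 ->
  Rabs (f t (x t) + w1 t) <= f0 * X + W1.
Proof.
  intros Ht HX HW; eapply Rle_trans; [apply Rabs_triang|].
  pose proof (Hf t (x t) Ht); nra.
Qed.

Lemma free_flow (l : nat) (r s X W1 : R) :
  0 <= r <= s -> s <= 2 * h ->
  (forall t, 3 * INR l * h <= t <= 3 * INR l * h + s -> Rabs (x t) <= X) ->
  (forall t, 0 <= t <= 3 * INR l * h + s -> Rabs (w1 t) <= W1) ->
  Rabs (x (3 * INR l * h + s) - x (3 * INR l * h + r)) <= (f0 * X + W1) * (s - r).
Proof.
  intros Hr Hs HX HW.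
  assert (Ha : 0 <= 3 * INR l * h) by (pose proof (pos_INR l); nra).
  destruct Hx as (Hcont & D & HD & Hder).
  destruct (HD (3 * INR l * h + s)) as [pts Hpts].
  replace (s - r) with (3 * INR l * h + s - (3 * INR l * h + r)) by ring.
  apply mean_value_half_line with pts; [lra | assumption |].
  intros t Ht Hn; eexists; split.
  - apply Hder; [lra|]; intros HDt; apply Hn, Hpts; [lra | assumption].
  - unfold control; rewrite (proj1 (Hg l t)) by lra.
    replace ((B0 + dB) * _ + f t (x t) + w1 t) with (f t (x t) + w1 t) by ring.
    apply drift_bound; [lra | apply HX; lra | apply HW; lra].
Qed.

(* The delayed state used in the control is within [h * M] of the midpoint of
   [x (3lh)] and [x ((3l+2)h)], whatever the delay, since both are reached from
   it by free flow in total time [2h].  Replacing it by this midpoint makes the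
   error at most [2h * M] as long as the total gain is at most 2. *)
Lemma driven_flow (l : nat) (s X W1 W2 : R) :
  0 <= 1 + dB / B0 <= 2 ->
  2 * h <= s <= 3 * h ->
  (forall t, 3 * INR l * h <= t <= 3 * INR l * h + s -> Rabs (x t) <= X) ->
  (forall t, 0 <= t <= 3 * INR l * h + s -> Rabs (w1 t) <= W1) ->
  (forall t, 0 <= t <= 3 * INR l * h + s -> Rabs (w2 t) <= W2) ->
  Rabs (x (3 * INR l * h + s)
        - (1 - (1 + dB / B0) * weight_fraction h S s) * x (3 * INR l * h))
    <= 3 * h * (f0 * X + W1) + (1 + dB / B0) * weight_fraction h S s * W2.
Proof.
  intros Hgain Hs HX HW1 HW2.
  set (k := 1 + dB / B0) in *; set (p := weight_fraction h S).
  set (M := f0 * X + W1).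
  pose proof (weight_mass_pos h S Hh HS) as HI.
  set (I := RInt S (2 * h) (3 * h)) in *.
  set (a := 3 * INR l * h) in *.
  assert (Ha : 0 <= a) by (unfold a; pose proof (pos_INR l); nra).
  assert (Hfree : forall r s', 0 <= r <= s' -> s' <= 2 * h ->
    Rabs (x (a + s') - x (a + r)) <= M * (s' - r)).
  { intros r s' Hr Hs'; apply free_flow; try assumption;
      intros; [apply HX | apply HW1]; unfold a in *; lra. }
  set (mid := (x a + x (a + 2 * h)) / 2).
  (* The distances to the two endpoints are at most [M * r] and [M * (2 * h - r)], whose average
     does not depend on [r]. *)
  assert (Hmid : forall r, 0 <= r <= 2 * h -> Rabs (x (a + r) - mid) <= h * M).
  { intros r Hr.
    assert (H1 := Hfree 0 r ltac:(lra) ltac:(lra)).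
    assert (H2 := Hfree r (2 * h) ltac:(lra) ltac:(lra)).
    rewrite Rplus_0_r in H1; apply Rabs_le_between in H1, H2.
    apply Rabs_le; unfold mid; lra. }
  destruct Hx as (Hcont & D & HD & Hder).
  destruct (HD (a + s)) as [pts Hpts].
  assert (Hp : forall t, a < t ->
    is_derive (fun t => p (t - a)) t (S (t - a) / I)).
  { intros t Ht.
    pose proof (is_derive_comp p (fun t => t - a) t (S (t - a) / I) 1) as H.
    rewrite <- (Rmult_1_l (S (t - a) / I)).
    apply H; [apply weight_fraction_derive; [assumption..|lra]|].
    auto_derive; [exact Logic.I | ring]. }
  assert (Hpc : forall t, a < t -> continuity_pt (fun t => p (t - a)) t).
  { intros t Ht; apply derivable_continuous_pt; eexists.
    apply is_derive_Reals, Hp, Ht. }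
  (* Adding [k * mid * p] cancels the part of the input due to [mid]. What remains in the derivative
     is the drift and the gain times the deviation from [mid] plus the noise [w2]. *)
  assert (Hdriven : Rabs ((x (a + s) + k * mid * p (a + s - a))
      - (x (a + 2 * h) + k * mid * p (a + 2 * h - a)))
    <= (k * (h * M + W2) * p (a + s - a) + M * (a + s))
       - (k * (h * M + W2) * p (a + 2 * h - a) + M * (a + 2 * h))).
  { apply (mean_value_inequality pts (fun t => x t + k * mid * p (t - a))
      (fun t => k * (h * M + W2) * p (t - a) + M * t)); [lra | |].
    - intros t Ht; split; apply continuity_pt_plus.
      + apply continuity_pt_half_line; [apply Hcont; unfold half_line; lra | lra].
      + apply (continuity_pt_scal (fun t => p (t - a))), Hpc; lra.
      + apply (continuity_pt_scal (fun t => p (t - a))), Hpc; lra.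
      + reg.
    - intros t Ht Hn; do 2 eexists; split; [|split].
      + apply (is_derive_plus x (fun t => k * mid * p (t - a))).
        * apply Hder; [lra|]; intros HDt; apply Hn, Hpts; [lra | assumption].
        * apply is_derive_scal, Hp; lra.
      + apply (is_derive_plus (fun t => k * (h * M + W2) * p (t - a)) (fun t => M * t)).
        * apply is_derive_scal, Hp; lra.
        * apply (is_derive_scal (fun t => t)), is_derive_id.
      + unfold control, output; rewrite (proj2 (Hg l t)) by (unfold a in *; lra).
        (* As [tau <= h], the sampling time [t - h - tau (t - h)] lies in the free phase from [a] to
           [a + 2 * h]. *)
        pose proof (Htau (t - h) ltac:(lra)) as Hd.
        pose proof (Hmid (t - a - h - tau (t - h)) ltac:(lra)) as Hz.
        replace (a + (t - a - h - tau (t - h))) with (t - h - tau (t - h)) in Hz by ring.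
        pose proof (HW2 (t - h) ltac:(lra)) as Hw.
        pose proof (drift_bound t X W1 ltac:(lra) (HX t ltac:(lra)) (HW1 t ltac:(lra)))
          as Hphi; fold M in Hphi.
        assert (HSt : S t = S (t - a)).
        { rewrite <- (weight_shift h S Hh HS l (t - a)) by lra; f_equal; unfold a; ring. }
        assert (Hq : 0 <= S (t - a) / I).
        { apply Rmult_le_pos; [apply (weight_nonneg h S HS); lra|].
          left; now apply Rinv_0_lt_compat. }
        unfold plus, scal, one, mult; simpl; unfold mult; simpl.
        replace ((B0 + dB) * (- B0 * / Wc h B0 S * S t * 1 *
            (x (t - h - tau (t - h)) + w2 (t - h))))
          with (- (k * (S (t - a) / I)) * (x (t - h - tau (t - h)) + w2 (t - h)))
          by (rewrite HSt; unfold k, Wc; fold I; field; split; [lra | assumption]).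
        assert (Hkq : 0 <= k * (S (t - a) / I)) by (apply Rmult_le_pos; lra).
        set (kq := k * (S (t - a) / I)) in *.
        set (z := x (t - h - tau (t - h))) in *.
        replace (k * (h * M + W2) * (S (t - a) / I)) with (kq * (h * M + W2))
          by (unfold kq; ring).
        replace (k * mid * (S (t - a) / I)) with (kq * mid) by (unfold kq; ring).
        apply Rabs_le_between in Hz, Hw, Hphi; apply Rabs_le; split; nra. }
  replace (a + s - a) with s in Hdriven by ring.
  replace (a + 2 * h - a) with (2 * h) in Hdriven by ring.
  unfold p at 2 4 in Hdriven; rewrite weight_fraction_start in Hdriven.
  assert (H0 := Hfree 0 (2 * h) ltac:(lra) ltac:(lra)); rewrite Rplus_0_r in H0.
  pose proof (weight_fraction_bounds h S Hh HS s Hs) as Hpb; fold p in Hpb.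
  assert (Hm : 0 <= k * p s <= 2) by nra.
  fold p; set (m := k * p s) in *.
  replace (k * mid * p s) with (m * mid) in Hdriven by (unfold m; ring).
  replace (k * (h * M + W2) * p s) with (m * (h * M + W2)) in Hdriven
    by (unfold m; ring).
  unfold mid in Hdriven.
  assert (HM : 0 <= M * h).
  { pose proof (Rabs_pos (x (a + 2 * h) - x a)); lra. }
  assert (HMs : M * s <= M * (3 * h)) by nra.
  (* The target is the quantity in [Hdriven] plus [(1 - m / 2) * (x (a + 2 * h) - x a)]. As
     [m <= 2], the latter is at most [2 * h * M - m * h * M], so the terms [m * h * M] cancel and
     [M * s + m * W2] remains. *)
  apply Rabs_le_between in Hdriven, H0; apply Rabs_le; split; nra.
Qed.

(** In the free phase the transition factor is 1, which [eta - 1] covers because [eta >= 2]; after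
    it, [driven_flow] applies. *)
Lemma window_flow (l : nat) (s X W1 W2 : R) :
  0 <= 1 + dB / B0 <= 2 ->
  0 <= s <= 3 * h ->
  (forall t, 3 * INR l * h <= t <= 3 * INR l * h + s -> Rabs (x t) <= X) ->
  (forall t, 0 <= t <= 3 * INR l * h + s -> Rabs (w1 t) <= W1) ->
  (forall t, 0 <= t <= 3 * INR l * h + s -> Rabs (w2 t) <= W2) ->
  Rabs (x (3 * INR l * h + s)) <=
    (eta h B0 dB S - 1) * Rabs (x (3 * INR l * h))
    + (3 * h * (f0 * X + W1) + alpha2 h B0 dB S * W2).
Proof.
  intros Hgain Hs HX HW1 HW2.
  assert (Ha : 0 <= 3 * INR l * h) by (pose proof (pos_INR l); nra).
  pose proof (HX (3 * INR l * h) ltac:(lra)) as HXa.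
  pose proof (HW1 0 ltac:(lra)) as HW1a; pose proof (HW2 0 ltac:(lra)) as HW2a.
  pose proof (Rabs_pos (x (3 * INR l * h))) as Hxa.
  pose proof (Rabs_pos (w1 0)); pose proof (Rabs_pos (w2 0)).
  assert (HM : 0 <= f0 * X + W1) by nra.
  rewrite (alpha2_eq h S Hh HS B0 dB HB0), (Rabs_pos_eq (1 + dB / B0)) by lra.
  pose proof (eta_ge_2 h S Hh HS B0 dB HB0) as Heta.
  destruct (Rle_dec s (2 * h)) as [Hs2|Hs2].
  - assert (H1 := free_flow l 0 s X W1 ltac:(lra) Hs2 HX HW1).
    rewrite Rplus_0_r in H1.
    pose proof (Rabs_triang (x (3 * INR l * h + s) - x (3 * INR l * h))
      (x (3 * INR l * h))) as H2.
    replace (_ - _ + _) with (x (3 * INR l * h + s)) in H2 by ring.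
    assert (0 <= (1 + dB / B0) * W2) by (apply Rmult_le_pos; lra).
    nra.
  - assert (Hs' : 2 * h <= s <= 3 * h) by lra.
    assert (H1 := driven_flow l s X W1 W2 Hgain Hs' HX HW1 HW2).
    assert (H2 := eta_ge_transition h S Hh HS B0 dB HB0 s Hs').
    assert (H3 := weight_fraction_bounds h S Hh HS s Hs').
    set (c := 1 - (1 + dB / B0) * weight_fraction h S s) in *.
    pose proof (Rabs_triang (x (3 * INR l * h + s) - c * x (3 * INR l * h))
      (c * x (3 * INR l * h))) as H4.
    replace (_ - _ + _) with (x (3 * INR l * h + s)) in H4 by ring.
    rewrite Rabs_mult in H4.
    assert ((1 + dB / B0) * weight_fraction h S s * W2 <= (1 + dB / B0) * W2).
    { apply Rmult_le_compat_r; [lra|].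
      rewrite <- Rmult_1_r; apply Rmult_le_compat_l; lra. }
    nra.
Qed.

(** At the end of a period the transition factor is exactly [Fmat]. This supplies the contraction,
    since [eta - 1] is at least 1. *)
Lemma period_flow (l : nat) (X W1 W2 : R) :
  0 <= 1 + dB / B0 <= 2 ->
  (forall t, 3 * INR l * h <= t <= 3 * INR l * h + 3 * h -> Rabs (x t) <= X) ->
  (forall t, 0 <= t <= 3 * INR l * h + 3 * h -> Rabs (w1 t) <= W1) ->
  (forall t, 0 <= t <= 3 * INR l * h + 3 * h -> Rabs (w2 t) <= W2) ->
  Rabs (x (3 * INR l * h + 3 * h)) <=
    Rabs (Fmat h B0 dB S) * Rabs (x (3 * INR l * h))
    + (3 * h * (f0 * X + W1) + alpha2 h B0 dB S * W2).
Proof.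
  intros Hgain HX HW1 HW2.
  assert (H1 := driven_flow l (3 * h) X W1 W2 Hgain ltac:(lra) HX HW1 HW2).
  rewrite (alpha2_eq h S Hh HS B0 dB HB0), (Rabs_pos_eq (1 + dB / B0)) by lra.
  rewrite (Fmat_eq h S Hh HS B0 dB HB0).
  rewrite (weight_fraction_end h S Hh HS) in H1.
  replace (1 - (1 + dB / B0) * 1) with (- (dB / B0)) in H1 by ring.
  pose proof (Rabs_triang
    (x (3 * INR l * h + 3 * h) - - (dB / B0) * x (3 * INR l * h))
    (- (dB / B0) * x (3 * INR l * h))) as H2.
  replace (_ - _ + _) with (x (3 * INR l * h + 3 * h)) in H2 by ring.
  rewrite Rabs_mult in H2; lra.
Qed.

(** * Composition of two periods under the small-gain condition *)

Context (tau0 : R).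
Hypotheses (Htau0 : tau0 <= h) (Hrho : rho h B0 dB f0 tau0 S 1 < 1).

(** The term [rho1 * f0] is nonnegative, so [eta * Rabs F < 1] with [eta >= 2]. This gives the gain
    bound that [driven_flow] assumes. *)
Lemma Fmat_lt_half : Rabs (Fmat h B0 dB S) < / 2.
Proof.
  unfold rho, rho1 in Hrho; rewrite pow_1 in Hrho.
  pose proof (eta_ge_2 h S Hh HS B0 dB HB0) as Heta.
  pose proof (alpha1_ge h S Hh HS B0 dB tau0 Htau0) as Ha1.
  pose proof (sup_power_sum_nonneg (Fmat h B0 dB S)) as Hsig.
  pose proof (Rabs_pos (Fmat h B0 dB S)) as HF.
  assert (0 <= alpha1 h B0 dB tau0 S * eta h B0 dB S * sup_power_sum (Fmat h B0 dB S)).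
  { repeat apply Rmult_le_pos; lra. }
  nra.
Qed.

Lemma rho_nonneg : 0 <= rho h B0 dB f0 tau0 S 1.
Proof.
  unfold rho, rho1; rewrite pow_1.
  pose proof (eta_ge_2 h S Hh HS B0 dB HB0) as Heta.
  pose proof (alpha1_ge h S Hh HS B0 dB tau0 Htau0) as Ha1.
  pose proof (sup_power_sum_nonneg (Fmat h B0 dB S)) as Hsig.
  pose proof (Rabs_pos (Fmat h B0 dB S)) as HF.
  assert (0 <= alpha1 h B0 dB tau0 S * eta h B0 dB S * sup_power_sum (Fmat h B0 dB S)).
  { repeat apply Rmult_le_pos; lra. }
  nra.
Qed.

Lemma delta_nonneg : 0 <= delta h B0 dB tau0 S.
Proof.
  unfold delta.
  pose proof (eta_ge_2 h S Hh HS B0 dB HB0) as Heta.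
  pose proof (alpha1_ge h S Hh HS B0 dB tau0 Htau0) as Ha1.
  pose proof (sup_power_sum_nonneg (Fmat h B0 dB S)) as Hsig.
  assert (0 <= alpha2 h B0 dB S).
  { rewrite (alpha2_eq h S Hh HS B0 dB HB0); apply Rabs_pos. }
  assert (0 <= eta h B0 dB S * sup_power_sum (Fmat h B0 dB S)
    * (alpha1 h B0 dB tau0 S + alpha2 h B0 dB S)).
  { repeat apply Rmult_le_pos; lra. }
  lra.
Qed.

(** The last complete period before [t] contributes the factor [Fmat], and the current, possibly
    partial, period contributes [eta - 1]. *)
Lemma two_period_recursion (t X W1 W2 : R) :
  6 * h <= t ->
  (forall s, t - 6 * h <= s <= t -> Rabs (x s) <= X) ->
  (forall s, 0 <= s <= t -> Rabs (w1 s) <= W1) ->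
  (forall s, 0 <= s <= t -> Rabs (w2 s) <= W2) ->
  Rabs (x t) <= rho h B0 dB f0 tau0 S 1 * X + delta h B0 dB tau0 S * (W1 + W2).
Proof.
  intros Ht HX HW1 HW2.
  pose proof Fmat_lt_half as HF.
  pose proof (Rabs_pos (Fmat h B0 dB S)) as HF0.
  assert (Hgain : 0 <= 1 + dB / B0 <= 2).
  { rewrite (Fmat_eq h S Hh HS B0 dB HB0), Rabs_Ropp in HF.
    apply Rabs_def2 in HF; lra. }
  destruct (nfloor_ex (t / (3 * h))) as [n [Hn1 Hn2]].
  { apply Rmult_le_pos; [lra | left; apply Rinv_0_lt_compat; lra]. }
  assert (Hn1' : 3 * INR n * h <= t).
  { apply Rmult_le_compat_r with (r := 3 * h) in Hn1; [|lra].
    unfold Rdiv in Hn1; rewrite Rmult_assoc, Rinv_l in Hn1; lra. }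
  assert (Hn2' : t < 3 * INR n * h + 3 * h).
  { apply Rmult_lt_compat_r with (r := 3 * h) in Hn2; [|lra].
    unfold Rdiv in Hn2; rewrite Rmult_assoc, Rinv_l in Hn2; lra. }
  (* A complete period precedes the one containing [t], and its start [3 * INR l * h] is later than
     [t - 6 * h], so [X] bounds the state on both. *)
  destruct n as [|l]; [simpl in Hn2'; lra|].
  assert (Hl : 3 * INR (Datatypes.S l) * h = 3 * INR l * h + 3 * h)
    by (rewrite S_INR; ring).
  assert (Ha : 0 <= 3 * INR l * h) by (pose proof (pos_INR l); nra).
  assert (H1 := period_flow l X W1 W2 Hgain).
  assert (H2 := window_flow (Datatypes.S l) (t - 3 * INR (Datatypes.S l) * h)
    X W1 W2 Hgain ltac:(lra)).
  rewrite Hl in H2.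
  replace (3 * INR l * h + 3 * h + (t - (3 * INR l * h + 3 * h))) with t in H2 by ring.
  specialize (H1 ltac:(intros; apply HX; lra) ltac:(intros; apply HW1; lra)
    ltac:(intros; apply HW2; lra)).
  specialize (H2 ltac:(intros; apply HX; lra) HW1 HW2).
  assert (H3 := HX (3 * INR l * h) ltac:(lra)).
  pose proof (Rabs_pos (x (3 * INR l * h))) as H4.
  pose proof (Rabs_pos (w1 0)); pose proof (HW1 0 ltac:(lra)).
  pose proof (Rabs_pos (w2 0)); pose proof (HW2 0 ltac:(lra)).
  pose proof (eta_ge_2 h S Hh HS B0 dB HB0) as Heta.
  pose proof (alpha1_ge h S Hh HS B0 dB tau0 Htau0) as Ha1.
  pose proof (sup_power_sum_ge_1 (Fmat h B0 dB S) ltac:(lra)) as Hsig.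
  assert (Ha2 : 0 <= alpha2 h B0 dB S).
  { rewrite (alpha2_eq h S Hh HS B0 dB HB0); apply Rabs_pos. }
  unfold rho, rho1, delta; rewrite pow_1.
  set (e := eta h B0 dB S) in *; set (F := Rabs (Fmat h B0 dB S)) in *.
  set (A1 := alpha1 h B0 dB tau0 S) in *; set (A2 := alpha2 h B0 dB S) in *.
  set (sg := sup_power_sum (Fmat h B0 dB S)) in *.
  set (xa := Rabs (x (3 * INR l * h))) in *.
  set (xb := Rabs (x (3 * INR l * h + 3 * h))) in *.
  assert (HX0 : 0 <= X) by lra.
  (* The factors [e] and [3 * h] are enlarged to [e * sg] and [A1] to reach [rho1] and [delta]. *)
  assert (Hes : e <= e * sg) by nra.
  assert (Hxb : xb <= F * X + (3 * h * (f0 * X + W1) + A2 * W2)) by nra.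
  assert (Hxt : Rabs (x t) <= e * F * X + e * (3 * h * (f0 * X + W1) + A2 * W2)).
  { assert ((e - 1) * xb <= (e - 1) * (F * X + (3 * h * (f0 * X + W1) + A2 * W2)))
      by (apply Rmult_le_compat_l; lra).
    assert (0 <= F * X) by (apply Rmult_le_pos; lra).
    lra. }
  assert (HfX : 0 <= f0 * X) by (apply Rmult_le_pos; lra).
  assert (HA : e * (3 * h) <= e * sg * A1) by (apply Rmult_le_compat; lra).
  assert (HA2 : e * A2 <= e * sg * A2) by (apply Rmult_le_compat_r; lra).
  assert (HeA2 : 0 <= e * sg * A2) by (apply Rmult_le_pos; lra).
  assert (HeA1 : 0 <= e * sg * A1) by (apply Rmult_le_pos; lra).
  assert (HfX_le : e * (3 * h) * (f0 * X) <= (e * sg * A1 + 3 * h + A1) * (f0 * X))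
    by (apply Rmult_le_compat_r; lra).
  assert (HW1_le : e * (3 * h) * W1 <= (e * sg * (A1 + A2) + 3 * h + A1 + A2) * W1)
    by (apply Rmult_le_compat_r; lra).
  assert (HW2_le : e * A2 * W2 <= (e * sg * (A1 + A2) + 3 * h + A1 + A2) * W2)
    by (apply Rmult_le_compat_r; lra).
  lra.
Qed.

End ClosedLoop.

Theorem proposition1 :
  forall (tauM h B0 dB eps f0 : R) (S g tau : R -> R)
    (f : R -> R -> R) (w1 w2 : R -> R),
  0 < tauM ->
  tauM <= h ->
  admissible_weight h S ->
  is_gate h g ->
  piecewise_continuous tau ->
  (forall t, 0 <= t -> 0 <= tau t <= tauM) ->
  B0 <> 0 ->
  0 <= eps ->
  Rabs dB <= eps ->
  (forall x t, half_line t -> continue_in (fun s => f s x) half_line t) ->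
  locally_lipschitz_in_x f ->
  0 <= f0 ->
  (forall t x, 0 <= t -> Rabs (f t x) <= f0 * Rabs x) ->
  piecewise_continuous w1 ->
  locally_bounded w1 ->
  piecewise_continuous w2 ->
  locally_bounded w2 ->
  (forall tau0 (l : nat), 0 <= tau0 <= tauM -> (1 <= l)%nat ->
     rho h B0 dB f0 tau0 S l < 1) ->
  forall x : R -> R,
  closed_loop_solution h B0 dB S g tau f w1 w2 x ->
  forall tau0, 0 <= tau0 <= tauM ->
  forall t, 6 * h <= t ->
  Rabs (x t) <=
    norm_on x 0 (6 * h) * decay h (rho h B0 dB f0 tau0 S 1) t
    + delta h B0 dB tau0 S * (norm_on w1 0 t + norm_on w2 0 t)
      / (1 - rho h B0 dB f0 tau0 S 1) ^ 2.
Proof.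
  intros tauM h B0 dB eps f0 S g tau f w1 w2 HtauM0 HtauM HS Hg _ Htau HB0 _ _ _ _
    Hf0 Hf _ Hw1 _ Hw2 Hrho x Hx tau0 Htau0 t Ht.
  assert (Hh : 0 < h) by lra.
  assert (Htau0h : tau0 <= h) by lra.
  assert (Hr1 := Hrho tau0 1%nat Htau0 (le_n 1)); clear Hrho.
  assert (Hr0 := rho_nonneg h B0 dB f0 S Hh HS HB0 Hf0 tau0 Htau0h).
  assert (Hd0 := delta_nonneg h B0 dB S Hh HS HB0 tau0 Htau0h).
  assert (Hrec := two_period_recursion tauM h B0 dB f0 S g tau f w1 w2 x
    Hh HtauM HS Hg Htau HB0 Hf0 Hf Hx tau0 Htau0h Hr1).
  set (r := rho h B0 dB f0 tau0 S 1) in *; set (dl := delta h B0 dB tau0 S) in *.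
  destruct (Hw1 t) as [M1 HM1]; destruct (Hw2 t) as [M2 HM2].
  assert (HN1 : forall s, 0 <= s <= t -> Rabs (w1 s) <= norm_on w1 0 t)
    by (intros s; now apply norm_on_ub with M1).
  assert (HN2 : forall s, 0 <= s <= t -> Rabs (w2 s) <= norm_on w2 0 t)
    by (intros s; now apply norm_on_ub with M2).
  set (W := norm_on w1 0 t + norm_on w2 0 t) in *.
  assert (HW : 0 <= W).
  { pose proof (HN1 0 ltac:(lra)); pose proof (HN2 0 ltac:(lra)).
    pose proof (Rabs_pos (w1 0)); pose proof (Rabs_pos (w2 0)); unfold W; lra. }
  assert (HV : forall s, 0 <= s <= 6 * h -> Rabs (x s) <= norm_on x 0 (6 * h)).
  { destruct (bounded_on_segment x (6 * h) (proj1 Hx)) as [M HM].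
    intros s; now apply norm_on_ub with M. }
  assert (HdW : 0 <= dl * W) by now apply Rmult_le_pos.
  eapply Rle_trans.
  - apply (halanay_bound (fun s => Rabs (x s)) h r (dl * W) (norm_on x 0 (6 * h)) t);
      try assumption; try lra.
    + pose proof (HV 0 ltac:(lra)); pose proof (Rabs_pos (x 0)); lra.
    + exact (bounded_on_segment x t (proj1 Hx)).
    + intros s X Hs HX; apply Hrec; [lra | assumption | |];
        intros; [apply HN1 | apply HN2]; lra.
  (* The decay lemma yields [/ (1 - r)], which is at most [/ (1 - r) ^ 2] because
     [0 < 1 - r <= 1]. *)
  - apply Rplus_le_compat_l, Rmult_le_compat_l; [assumption|].
    apply Rinv_le_contravar; [apply pow_lt; lra | nra].
Qed.
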